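(* Let $(N,\Sigma,\beta)$ be a stacky fan with $\beta:\mathbb{Z}^n\to N$, and let $[Z_\Sigma/G]$ be its corresponding toric Deligne-Mumford stack. For a point $z=(z_1,\ldots,z_n)\in Z_\Sigma\subset\mathbb{C}^n$, let $N_z\subset N$ denote the submodule generated by $\{\beta(e_i)\mid z_i=0\}$. Then the isotropy group $\mathrm{Stab}(z)=\{g\in G\mid g\cdot z=z\}$ is isomorphic to $\mathrm{Hom}_{\mathbb{Z}}(\mathrm{Ext}^1_{\mathbb{Z}}(N/N_z,\mathbb{Z}),\mathbb{T})$; therefore $\mathrm{Stab}(z)$ is (non-canonically) isomorphic to the torsion submodule $\mathrm{Tor}(N/N_z)$ of $N/N_z$.
   Context: Notation: $\mathbb{T}=\mathbb{C}^\times$; $(-)^\star=\mathrm{Hom}_{\mathbb{Z}}(-,\mathbb{Z})$; $e_1,\dots,e_n$ is the standard basis of $\mathbb{Z}^n$. A stacky fan $(N,\Sigma,\beta)$ consists of a finitely generated abelian group $N$ of rank $d$, a rational simplicial fan $\Sigma$ in $N\otimes\mathbb{R}$ with rays $\rho_1,\ldots,\rho_n$, and a homomorphism $\beta:\mathbb{Z}^n\to N$ such that (1) the rays $\rho_1,\dots,\rho_n$ span $N\otimes\mathbb{R}$, and (2) for each $j$, $\beta(e_j)\otimes 1$ lies on (and generates) the ray $\rho_j$. The toric Deligne-Mumford stack $\mathcal{X}(N,\Sigma,\beta)=[Z_\Sigma/G]$ (a quotient stack over smooth manifolds) is defined as follows. Let $J(\Sigma)\subset\mathbb{C}[z_1,\dots,z_n]$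 be the ideal generated by the monomials $\prod_{\rho_i\not\subset\sigma}z_i$, $\sigma\in\Sigma$, and $Z_\Sigma=\mathbb{C}^n\smallsetminus V(J(\Sigma))$; equivalently, $z\in Z_\Sigma$ iff there is a cone $\sigma\in\Sigma$ with $\{i\mid z_i=0\}\subset\{i\mid\rho_i\subset\sigma\}$. Choose a free resolution $0\to\mathbb{Z}^\ell\xrightarrow{Q}\mathbb{Z}^{d+\ell}\to N\to 0$ and a lift $B:\mathbb{Z}^n\to\mathbb{Z}^{d+\ell}$ of $\beta$. Let $[B\,Q]:\mathbb{Z}^{n+\ell}=\mathbb{Z}^n\oplus\mathbb{Z}^\ell\to\mathbb{Z}^{d+\ell}$ be the map restricting to $B$ and $Q$ on the two summands, set $\mathrm{DG}(\beta)=(\mathbb{Z}^{n+\ell})^\star/\mathrm{im}\,[B\,Q]^\star$, and let $\beta^\vee:(\mathbb{Z}^n)^\star\to\mathrm{DG}(\beta)$ be the inclusion $(\mathbb{Z}^n)^\star\to(\mathbb{Z}^{n+\ell})^\star$ (first $n$ coordinates) followed by the quotient map. Put $G=\mathrm{Hom}_{\mathbb{Z}}(\mathrm{DG}(\beta),\mathbb{T})$. Applying $\mathrm{Hom}_{\mathbb{Z}}(-,\mathbb{T})$ to $\beta^\vee$ gives a homomorphism $G\to\mathbb{T}^n$, through which $G$ acts on $\mathbb{C}^n$ (coordinatewise multiplication) preserving $Z_\Sigma$. *)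

(* Defs.v *)
From HB Require Import structures.
From mathcomp Require Import all_boot all_order all_algebra.
From mathcomp Require Import boolp classical_sets functions cardinality reals.
From mathcomp Require Import complex.
From mathcomp Require Import freeg.

Set Implicit Arguments.
Unset Strict Implicit.
Unset Printing Implicit Defensive.

Import Order.TTheory GRing.Theory Num.Theory.
Local Open Scope classical_set_scope.
Local Open Scope ring_scope.

Definition isomorphic (A B : zmodType) : Prop :=
  exists f : {additive A -> B}, bijective f.

Definition homZ (A B : zmodType) : Type := {additive A -> B}.

Section HomZ.
Variables A B : zmodType.

HB.instance Definition _ := gen_eqMixin (homZ A B).
HB.instance Definition _ := gen_choiceMixin (homZ A B).

Lemma homZ_ext (f g : homZ A B) : f =1 g -> f = g.
Proof.
case: f => f [[f0]]; case: g => g [[g0]].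
by move=> /funext /= fg; subst g; rewrite (Prop_irrelevance f0 g0).
Qed.

Definition homZ_zero : homZ A B := (\0 : {additive A -> B}).
Definition homZ_opp (f : homZ A B) : homZ A B := (\- f : {additive A -> B}).
Definition homZ_add (f g : homZ A B) : homZ A B := (f \+ g : {additive A -> B}).

Fact homZ_addA : associative homZ_add.
Proof. by move=> f g h; apply: homZ_ext => x; exact: addrA. Qed.
Fact homZ_addC : commutative homZ_add.
Proof. by move=> f g; apply: homZ_ext => x; exact: addrC. Qed.
Fact homZ_add0 : left_id homZ_zero homZ_add.
Proof. by move=> f; apply: homZ_ext => x; exact: add0r. Qed.
Fact homZ_addN : left_inverse homZ_zero homZ_opp homZ_add.
Proof. by move=> f; apply: homZ_ext => x; exact: addNr. Qed.

HB.instance Definition _ :=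
  GRing.isZmodule.Build (homZ A B) homZ_addA homZ_addC homZ_add0 homZ_addN.

End HomZ.

Notation dualZ A := (homZ A int).

Section HomZPre.
Variables (A A' B : zmodType) (f : {additive A' -> A}).

Definition homZ_pre (h : homZ A B) : homZ A' B :=
  ((h : {additive A -> B}) \o f : {additive A' -> B}).

Fact homZ_pre_is_zmod_morphism : zmod_morphism homZ_pre.
Proof. by move=> g h; apply: homZ_ext. Qed.

HB.instance Definition _ :=
  GRing.isZmodMorphism.Build (homZ A B) (homZ A' B) homZ_pre
    homZ_pre_is_zmod_morphism.

End HomZPre.

Definition subgroup (A : zmodType) (I : zmodClosed A) : Type :=
  {x : A | x \in I}.

Section Subgroup.
Variables (A : zmodType) (I : zmodClosed A).
HB.instance Definition _ := [isSub of subgroup I for sval].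
HB.instance Definition _ := [Choice of subgroup I by <:].
HB.instance Definition _ := [SubChoice_isSubZmodule of subgroup I by <:].
End Subgroup.

Section Ker.
Variables (A B : zmodType) (f : {additive A -> B}).

Definition kerZ : {pred A} := fun x => f x == 0.

Fact kerZ_closed : zmod_closed kerZ.
Proof.
split=> [|x y]; rewrite !unfold_in ?raddf0 //.
by move=> /eqP fx /eqP fy; rewrite raddfB fx fy subrr.
Qed.

HB.instance Definition _ := GRing.isZmodClosed.Build A kerZ kerZ_closed.

Definition imZ : {pred B} := fun y => `[< exists x, f x = y >].

Fact imZ_closed : zmod_closed imZ.
Proof.
split=> [|_ _ /asboolP[x <-] /asboolP[y <-]]; apply/asboolP.
  by exists 0; rewrite raddf0.
by exists (x - y); rewrite raddfB.
Qed.

HB.instance Definition _ := GRing.isZmodClosed.Build B imZ imZ_closed.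

Definition cokerZ : zmodType := Quotient.quot (imZ : zmodClosed B).

End Ker.

Section Gen.
Variables (A : zmodType) (S : set A).

Definition genZ : {pred A} := fun x =>
  `[< forall I : zmodClosed A, (forall s, S s -> s \in I) -> x \in I >].

Fact genZ_closed : zmod_closed genZ.
Proof.
split=> [|x y /asboolP Sx /asboolP Sy]; apply/asboolP=> I SI.
  exact: rpred0.
by apply: rpredB; [exact: Sx | exact: Sy].
Qed.

HB.instance Definition _ := GRing.isZmodClosed.Build A genZ genZ_closed.

End Gen.

Section Torsion.
Variable A : zmodType.

Definition torsionZ : {pred A} := fun x =>
  `[< exists2 k : nat, (0 < k)%N & x *+ k = 0 >].

Fact torsionZ_closed : zmod_closed torsionZ.
Proof.
split=> [|x y /asboolP[j j0 xj] /asboolP[k k0 yk]]; apply/asboolP.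
  by exists 1%N.
exists (j * k)%N; first by rewrite muln_gt0 j0.
by rewrite mulrnBl mulrnA xj mul0rn mulnC mulrnA yk mul0rn subrr.
Qed.

HB.instance Definition _ := GRing.isZmodClosed.Build A torsionZ torsionZ_closed.

Definition Tor : zmodType := subgroup (torsionZ : zmodClosed A).

End Torsion.

Definition finitely_generated (A : zmodType) : Prop :=
  exists s : seq A, forall x, x \in genZ [set y | y \in s].

Definition short_exact (A B C : zmodType)
    (f : {additive A -> B}) (g : {additive B -> C}) : Prop :=
  [/\ injective f,
      (forall y, g y = 0 <-> exists x, f x = y) &
      (forall c, exists y, g y = c)].

(* Ext^1(A, B) is computed from the free resolution
   0 -> ker eps -> Z[A] -> A -> 0, where Z[A] is the free abelian group on the
   underlying set of A and eps sends the generator <<a>> to a. *)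

Section Ext1.
Variable A : zmodType.

(* [zmodule A] is A viewed as a module over int. *)
Definition freeZ_eps (D : {freeg A / int}) : A :=
  fglift (id : A -> zmodule A) D.

Fact freeZ_eps_is_zmod_morphism : zmod_morphism freeZ_eps.
Proof. exact: (lift_is_additive (M := zmodule A)). Qed.

HB.instance Definition _ :=
  GRing.isZmodMorphism.Build {freeg A / int} A freeZ_eps
    freeZ_eps_is_zmod_morphism.

Definition freeZ_ker : zmodType := subgroup (kerZ freeZ_eps : zmodClosed _).

Definition freeZ_incl : {additive freeZ_ker -> {freeg A / int}} := val.

Definition Ext1 (B : zmodType) : zmodType :=
  cokerZ (homZ_pre freeZ_incl : {additive homZ _ B -> homZ _ B}).

End Ext1.

(* The multiplicative group of a field is made a [zmodType], so its group law
   is written additively: [val (s + t) = val s * val t] and [val 0 = 1]. *)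

Definition Gm (K : fieldType) : Type := {x : K | x != 0}.

Section Gm.
Variable K : fieldType.
HB.instance Definition _ := [isSub of Gm K for sval].
HB.instance Definition _ := [Choice of Gm K by <:].

Definition Gm_one : Gm K := Sub 1 (oner_neq0 K).
Fact Gm_mul_subproof (s t : Gm K) : val s * val t != 0.
Proof. by rewrite mulf_neq0 ?(valP s) ?(valP t). Qed.
Definition Gm_mul (s t : Gm K) : Gm K := Sub (val s * val t) (Gm_mul_subproof s t).
Fact Gm_inv_subproof (s : Gm K) : (val s)^-1 != 0.
Proof. by rewrite invr_neq0 ?(valP s). Qed.
Definition Gm_inv (s : Gm K) : Gm K := Sub (val s)^-1 (Gm_inv_subproof s).

Fact Gm_mulA : associative Gm_mul.
Proof. by move=> s t u; apply: val_inj; rewrite /= mulrA. Qed.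
Fact Gm_mulC : commutative Gm_mul.
Proof. by move=> s t; apply: val_inj; rewrite /= mulrC. Qed.
Fact Gm_mul1 : left_id Gm_one Gm_mul.
Proof. by move=> s; apply: val_inj; rewrite /= mul1r. Qed.
Fact Gm_mulV : left_inverse Gm_one Gm_inv Gm_mul.
Proof. by move=> s; apply: val_inj; rewrite /= mulVf ?(valP s). Qed.

HB.instance Definition _ :=
  GRing.isZmodule.Build (Gm K) Gm_mulA Gm_mulC Gm_mul1 Gm_mulV.

Lemma val_GmD (s t : Gm K) : val (s + t) = val s * val t. Proof. by []. Qed.
Lemma val_GmN (s : Gm K) : val (- s) = (val s)^-1. Proof. by []. Qed.
Lemma val_Gm0 : val (0 : Gm K) = 1. Proof. by []. Qed.
End Gm.

Section Fan.
Variables (R : realType) (N : zmodType) (V : vectType R).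
Variable iota : {additive N -> V}.

(* [iota : N -> V], x |-> x (x) 1, exhibits V as the scalar extension of N. *)
Definition is_real_extension : Prop :=
  forall (W : lmodType R) (f : {additive N -> W}),
    exists2 g : {linear V -> W}, (forall x, g (iota x) = f x) &
      forall g' : {linear V -> W}, (forall x, g' (iota x) = f x) -> g' =1 g.

Definition cone (vs : seq V) : set V :=
  [set x | exists2 a : 'I_(size vs) -> R,
     (forall i, 0 <= a i) & x = \sum_i a i *: vs`_i].

Definition is_ray (sigma : set V) : Prop :=
  exists2 v : V, v != 0 & sigma = cone [:: v].

Definition is_face (tau sigma : set V) : Prop :=
  exists2 u : {linear V -> R^o},
    (forall x, sigma x -> 0 <= u x) & tau = sigma `&` [set x | u x = 0].

Record is_rational_simplicial_fan (Sigma : set (set V)) : Prop := {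
  fan_finite : finite_set Sigma;
  fan_nonempty : Sigma !=set0;
  fan_rational : forall sigma, Sigma sigma ->
    exists s : seq N, sigma = cone [seq iota x | x <- s];
  fan_strongly_convex : forall sigma, Sigma sigma ->
    forall x, sigma x -> sigma (- x) -> x = 0;
  fan_simplicial : forall sigma, Sigma sigma ->
    exists2 vs : seq V, free vs & sigma = cone vs;
  fan_face : forall sigma tau, Sigma sigma -> is_face tau sigma -> Sigma tau;
  fan_meet : forall sigma tau, Sigma sigma -> Sigma tau ->
    is_face (sigma `&` tau) sigma /\ is_face (sigma `&` tau) tau
}.

End Fan.

Definition stdb (n : nat) (i : 'I_n) : 'rV[int]_n := delta_mx 0 i.

Record is_stacky_fan (R : realType) (N : zmodType) (V : vectType R)
    (iota : {additive N -> V}) (d n : nat) (Sigma : set (set V))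
    (rho : 'I_n -> set V) (beta : {additive 'rV[int]_n -> N}) : Prop := {
  sf_fg : finitely_generated N;
  sf_extension : is_real_extension iota;
  sf_rank : \dim {: V} = d;
  sf_fan : is_rational_simplicial_fan iota Sigma;
  sf_rho_inj : injective rho;
  sf_rho : range rho = [set sigma | Sigma sigma /\ is_ray sigma];
  sf_span : forall U : {vspace V},
    (forall j x, rho j x -> x \in U) -> U = fullv;
  sf_beta : forall j, rho j = cone [:: iota (beta (stdb j))]
}.

(* This is the complement of the common zero locus of the monomials
   \prod_(j | ~ rho j `<=` sigma) z_j, for sigma in Sigma. *)
Definition Z_Sigma (R : realType) (V : vectType R) (n : nat)
    (Sigma : set (set V)) (rho : 'I_n -> set V) : set 'rV[R[i]]_n :=
  [set z : 'rV[R[i]]_n | exists2 sigma, Sigma sigma &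
     forall j, z 0 j = 0 -> rho j `<=` sigma].

Definition stdb_dual (n : nat) (j : 'I_n) (x : 'rV[int]_n) : int := x 0 j.

Fact stdb_dual_is_zmod_morphism n (j : 'I_n) : zmod_morphism (stdb_dual j).
Proof. by move=> x y; rewrite /stdb_dual !mxE. Qed.

HB.instance Definition _ n (j : 'I_n) :=
  GRing.isZmodMorphism.Build 'rV[int]_n int (stdb_dual j)
    (stdb_dual_is_zmod_morphism j).

Section Action.
Variables (K : fieldType) (n l m : nat).
Variables (B : {additive 'rV[int]_n -> 'rV[int]_m}).
Variables (Q : {additive 'rV[int]_l -> 'rV[int]_m}).

Definition BQ : {additive 'rV[int]_(n + l) -> 'rV[int]_m} :=
  (B \o lsubmx) \+ (Q \o rsubmx).

Definition DG : zmodType :=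
  cokerZ (homZ_pre BQ : {additive dualZ _ -> dualZ _}).

Definition beta_vee : {additive dualZ 'rV[int]_n -> DG} :=
  (\pi_DG)%qT \o homZ_pre (lsubmx : {additive 'rV[int]_(n + l) -> 'rV[int]_n}).

Definition toric_group : zmodType := homZ DG (Gm K).

(* Hom((Z^n)^*, T) is identified with T^n by evaluation at the dual basis. *)
Definition G_to_torus (g : toric_group) (j : 'I_n) : Gm K :=
  homZ_pre beta_vee g (stdb_dual j : {additive _ -> _}).

Lemma G_to_torusB g h j : G_to_torus (g - h) j = G_to_torus g j - G_to_torus h j.
Proof. by []. Qed.

Definition act (g : toric_group) (z : 'rV[K]_n) : 'rV[K]_n :=
  \row_j (val (G_to_torus g j) * z 0 j).

Definition stab (z : 'rV[K]_n) : {pred toric_group} := fun g => act g z == z.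

Fact stab_closed z : zmod_closed (stab z).
Proof.
have stabP g : reflect (forall j, val (G_to_torus g j) * z 0 j = z 0 j)
    (g \in stab z).
  apply: (iffP eqP) => [/rowP gz j | gz]; first by have := gz j; rewrite mxE.
  by apply/rowP => j; rewrite mxE.
split=> [|g h /stabP gz /stabP hz]; apply/stabP => j.
  by rewrite /G_to_torus /= mul1r.
rewrite G_to_torusB val_GmD val_GmN.
by rewrite -[in LHS](hz j) mulrA mulrVK ?unitfE ?(valP (G_to_torus h j)).
Qed.

HB.instance Definition _ z :=
  GRing.isZmodClosed.Build toric_group (stab z) (stab_closed z).

Definition Stab (z : 'rV[K]_n) : zmodType :=
  subgroup (stab z : zmodClosed toric_group).

End Action.

(* The subgroup N_z of N. *)
Definition N_zero (N : zmodType) (K : fieldType) (n : nat)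
    (beta : {additive 'rV[int]_n -> N}) (z : 'rV[K]_n) : zmodClosed N :=
  genZ [set beta (stdb j) | j in [set j | z 0 j = 0]].

(* Main.v *)
Require Import Defs.
From mathcomp Require Import all_boot all_order all_algebra.
From mathcomp Require Import boolp classical_sets functions cardinality reals.
From mathcomp Require Import complex.
From HB Require Import structures.
From mathcomp Require Import cyclic separable cyclotomic freeg.

Set Implicit Arguments.
Unset Strict Implicit.
Unset Printing Implicit Defensive.

Import Order.TTheory GRing.Theory Num.Theory.
Local Open Scope classical_set_scope.
Local Open Scope quotient_scope.
Local Open Scope ring_scope.

(** Write [T] for the multiplicative group, [A] for [N / N_z] and [m] for
[d + l].  Let [K] be the subgroup of [Z^(n+l)] of the vectors whose [j]-th
coordinate vanishes whenever [z_j <> 0], and [i : K -> Z^m] the restriction of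
[[B Q]].

The stabilizer of [z] consists of the homomorphisms [DG -> T] that kill the
classes of the coordinate forms [e_j^*] with [z_j <> 0].  Killing these forms
in [(Z^(n+l))^*] leaves [K^*], so the stabilizer is [Hom(coker i^*, T)]
([Stab_dual_coker]).

The geometry enters once: as [z] lies in [Z_Sigma], the rays [rho_j] with
[z_j = 0] lie in one simplicial cone of the fan, hence are edges of that cone,
and their generators are linearly independent ([cone_rays_free]).  Therefore
[beta] is injective on the vectors supported on these [j], [i] is injective,
and [0 -> K -> Z^m -> A -> 0] is a free resolution
([short_exact_quot_N_zero]).  Since [Ext^1] may be computed from any free
resolution ([Ext1_resolution]), [coker i^*] is [Ext^1(A, Z)]; this is the
first isomorphism.

For the second one, both [Hom(coker i^*, T)] and [Tor A] are subquotients of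
[K] ([dual_coker_Tor]).  Over the rationals [i] has a left inverse, so some
integer [c > 0] satisfies [c = r i] with [r : Z^m -> K].  Such a [c]
annihilates both groups.  Consider the pairs [(y, x)] in [K * Z^m] with
[i y = c x].  Sending such a pair to the class of [x] in [A] gives all torsion
elements, because [i (r x) = c x] whenever a multiple of [x] lies in the image
of [i].  Sending it to the character [h |-> u^(h y)], where [u] is a primitive [c]-th root of
unity, gives all characters of [coker i^*].  In both cases the pairs sent to
the neutral element are those with [y] divisible by [c].  The choice of [u] is
the reason why the isomorphism is not canonical. *)

(** * Homomorphisms, isomorphisms and quotients of abelian groups *)

Lemma exists_additive (A B : zmodType) (f : A -> B) :
  zmod_morphism f -> exists g : {additive A -> B}, g =1 f.
Proof.
move=> fB; pose m := GRing.isZmodMorphism.Build A B f fB.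
pose g : {additive A -> B} := HB.pack f m.
by exists g.
Qed.

(** An additive relation that is total and surjective and relates [0] only to
[0], on both sides, is the graph of an isomorphism.  Each pair of groups
compared below is related through a third group, where this form avoids
choosing representatives. *)
Lemma isomorphic_of_rel (A B : zmodType) (r : A -> B -> Prop) :
    (forall a b a' b', r a b -> r a' b' -> r (a - a') (b - b')) ->
    (forall a, exists b, r a b) -> (forall b, exists a, r a b) ->
    (forall b, r 0 b -> b = 0) -> (forall a, r a 0 -> a = 0) ->
  isomorphic A B.
Proof.
move=> rB /choice[f rf] /choice[g rg] r0l r0r.
have uniqr a b b' : r a b -> r a b' -> b = b'.
  by move=> ab ab'; apply/subr0_eq/r0l; rewrite -(subrr a); apply: rB.
have uniql a a' b : r a b -> r a' b -> a = a'.
  by move=> ab ab'; apply/subr0_eq/r0r; rewrite -(subrr b); apply: rB.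
have [|h hf] := @exists_additive A B f.
  by move=> a a'; apply: (uniqr (a - a')); [exact: rf | exact: rB].
exists h; exists g => [a|b]; rewrite hf.
  by apply: (uniql _ _ (f a)).
by apply: (uniqr (g b)).
Qed.

Lemma isomorphic_trans (A B C : zmodType) :
  isomorphic A B -> isomorphic B C -> isomorphic A C.
Proof. by move=> [f fB] [g gB]; exists (g \o f); exact: bij_comp. Qed.

Section Quotient.
Variables (A : zmodType) (I : zmodClosed A).
Implicit Types a : A.

Lemma quot_surj (x : Quotient.quot I) : exists a, \pi a = x.
Proof. by exists (repr x); rewrite reprK. Qed.

Lemma quot_eq0 a : a \in I <-> \pi_(Quotient.quot I) a = 0.
Proof.
rewrite -[a in a \in I]subr0 Quotient.idealrBE.
rewrite -[0 in X in _ <-> X](raddf0 (\pi_(Quotient.quot I))).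
by split=> /eqP.
Qed.

Lemma quot_lift (B : zmodType) (f : {additive A -> B}) :
    (forall a, a \in I -> f a = 0) ->
  exists g : {additive Quotient.quot I -> B}, forall a, g (\pi a) = f a.
Proof.
move=> fI.
have eqf a b : \pi_(Quotient.quot I) a = \pi b -> f a = f b.
  move=> ab; apply/subr0_eq; rewrite -raddfB; apply/fI/quot_eq0.
  by rewrite raddfB /= ab subrr.
have [|g gE] := @exists_additive (Quotient.quot I) B (f \o repr).
  by move=> x y /=; rewrite -raddfB; apply: eqf; rewrite raddfB /= !reprK.
by exists g => a; rewrite gE /=; apply: eqf; rewrite reprK.
Qed.

End Quotient.

Lemma cokerZ_eq0 (A B : zmodType) (f : {additive A -> B}) (y : B) :
  \pi_(cokerZ f) y = 0 <-> exists x, f x = y.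
Proof.
by rewrite -quot_eq0; split=> /asboolP.
Qed.

Lemma isomorphic_homZ (A A' B : zmodType) :
  isomorphic A A' -> isomorphic (homZ A B) (homZ A' B).
Proof.
move=> [f [f' fK f'K]].
have [|g gE] := @exists_additive A' A f'.
  by move=> x y; apply: (can_inj fK); rewrite raddfB !f'K.
exists (homZ_pre g : {additive homZ A B -> homZ A' B}); exists (homZ_pre f) => h;
  by apply: homZ_ext => x /=; rewrite gE ?fK ?f'K.
Qed.

Section HomZEval.
Variables A B : zmodType.

(** Evaluation is named so that its additivity can be inferred, for instance
when a sum of homomorphisms is applied to a point. *)
Definition homZ_eval (a : A) (h : homZ A B) : B := h a.

Fact homZ_eval_is_zmod_morphism a : zmod_morphism (homZ_eval a).
Proof. by []. Qed.

HB.instance Definition _ a :=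
  GRing.isZmodMorphism.Build (homZ A B) B (homZ_eval a)
    (homZ_eval_is_zmod_morphism a).

End HomZEval.

(** * Projective abelian groups *)

Definition projectiveZ (F : zmodType) : Prop :=
  forall (X Y : zmodType) (g : {additive X -> Y}) (f : {additive F -> Y}),
    (forall y, exists x, g x = y) ->
  exists f' : {additive F -> X}, forall v, g (f' v) = f v.

Lemma additive_rV (m : nat) (A : zmodType) (f : {additive 'rV[int]_m -> A}) v :
  f v = \sum_a f (stdb a) *~ v 0 a.
Proof.
rewrite {1}[v]row_sum_delta raddf_sum /=; apply: eq_bigr => a _.
by rewrite -raddfMz -scaler_int intz.
Qed.

Lemma dual_rV (m : nat) (h : dualZ 'rV[int]_m) :
  h = \sum_a (stdb_dual a : dualZ 'rV[int]_m) *~ h (stdb a).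
Proof.
apply: homZ_ext => v; rewrite additive_rV -[RHS]/(homZ_eval v _) raddf_sum.
by apply: eq_bigr => a _; rewrite raddfMz /homZ_eval /= /stdb_dual !mulrzz mulrC.
Qed.

Lemma projectiveZ_rV (m : nat) : projectiveZ 'rV[int]_m.
Proof.
move=> X Y g f g_surj.
have /choice[x gx] a : exists x, g x = f (stdb a) by [].
have [|f' f'E] := @exists_additive 'rV[int]_m X (fun v => \sum_a x a *~ v 0 a).
  move=> v w; rewrite -sumrB; apply: eq_bigr => a _.
  by rewrite !mxE mulrzBr.
exists f' => v; rewrite f'E raddf_sum [RHS]additive_rV.
by apply: eq_bigr => a _; rewrite raddfMz /= gx.
Qed.

Lemma freeg_ext (S : choiceType) (Y : zmodType)
    (f g : {additive {freeg S / int} -> Y}) :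
  (forall s, f << s >> = g << s >>) -> f =1 g.
Proof.
move=> fg D; rewrite -[D]freeg_sumE !raddf_sum; apply: eq_bigr => s _.
have -> : << coeff s D *g s >> = << s >> *~ coeff s D :> {freeg S / int}.
  by rewrite freegU_mulz intz.
by rewrite !raddfMz fg.
Qed.

Lemma freeg_lift (S : choiceType) (X : zmodType) (x : S -> X) :
  exists f : {additive {freeg S / int} -> X}, forall s, f << s >> = x s.
Proof.
have [|f fE] := @exists_additive {freeg S / int} X
    (fun D => fglift (x : S -> zmodule X) D).
  exact: (lift_is_additive (M := zmodule X)).
by exists f => s; rewrite fE liftU scale1r.
Qed.

Lemma projectiveZ_freeg (S : choiceType) : projectiveZ {freeg S / int}.
Proof.
move=> X Y g f g_surj.
have /choice[x gx] s : exists x, g x = f << s >> by [].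
have [f' f'E] := freeg_lift x; exists f'.
by apply: (@freeg_ext _ _ (g \o f') f) => s /=; rewrite f'E gx.
Qed.

(** * Independence of the first extension group from the resolution *)

Section Resolutions.
Variables (K F A : zmodType) (i : {additive K -> F}) (q : {additive F -> A}).
Hypothesis iq : short_exact i q.

Lemma short_exact_factor (X : zmodType) (f : {additive X -> F}) :
    (forall x, q (f x) = 0) ->
  exists s : {additive X -> K}, forall x, i (s x) = f x.
Proof.
case: iq => i_inj iqE _ qf.
have /choice[s sE] x : exists y, i y = f x by apply/iqE.
have [|s' s'E] := @exists_additive X K s.
  by move=> x y; apply: i_inj; rewrite raddfB !sE raddfB.
by exists s' => x; rewrite s'E.
Qed.

Lemma short_exact_comp0 x : q (i x) = 0.
Proof. by case: iq => _ iqE _; apply/iqE; exists x. Qed.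

End Resolutions.

Lemma resolution_lift (K F K' F' A : zmodType)
    (i : {additive K -> F}) (q : {additive F -> A})
    (i' : {additive K' -> F'}) (q' : {additive F' -> A}) :
    short_exact i q -> short_exact i' q' -> projectiveZ F' ->
  exists (phi : {additive F' -> F}) (phiK : {additive K' -> K}),
    (forall v, q (phi v) = q' v) /\ (forall x, i (phiK x) = phi (i' x)).
Proof.
move=> iq iq' /[dup] projF' /(_ _ _ q q')[|phi phiE]; first by case: iq.
have [|phiK phiKE] := @short_exact_factor _ _ _ i q iq _ (phi \o i').
  by move=> x; rewrite /= phiE (short_exact_comp0 iq').
by exists phi, phiK.
Qed.

(** Lift the identity of [A] to maps of resolutions [phi] and [psi] in both
directions.  Each composite differs from the identity by a map into the kernel
term ([s] and [s']).  Restricted to the kernel term, that difference factors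
through the inclusion, so it vanishes in the cokernel of the dual map. *)
Lemma coker_dual_resolution (K F K' F' A B : zmodType)
    (i : {additive K -> F}) (q : {additive F -> A})
    (i' : {additive K' -> F'}) (q' : {additive F' -> A}) :
    short_exact i q -> short_exact i' q' -> projectiveZ F -> projectiveZ F' ->
  isomorphic (cokerZ (homZ_pre i : {additive homZ F B -> homZ K B}))
             (cokerZ (homZ_pre i' : {additive homZ F' B -> homZ K' B})).
Proof.
move=> iq iq' projF projF'.
have [phi [phiK [phiE phiKE]]] := resolution_lift iq iq' projF'.
have [psi [psiK [psiE psiKE]]] := resolution_lift iq' iq projF.
have [s sE] : exists s : {additive F -> K},
    forall v, i (s v) = phi (psi v) - v.
  apply: (short_exact_factor iq (f := (phi \o psi) \- idfun)) => v.
  by rewrite /= raddfB phiE psiE subrr.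
have [s' s'E] : exists s' : {additive F' -> K'},
    forall v, i' (s' v) = psi (phi v) - v.
  apply: (short_exact_factor iq' (f := (psi \o phi) \- idfun)) => v.
  by rewrite /= raddfB psiE phiE subrr.
have siE x : s (i x) = phiK (psiK x) - x.
  by case: iq => i_inj _ _; apply: i_inj; rewrite sE raddfB phiKE psiKE.
have s'iE x : s' (i' x) = psiK (phiK x) - x.
  by case: iq' => i_inj _ _; apply: i_inj; rewrite s'E raddfB psiKE phiKE.
pose piK : {additive homZ K B ->
  cokerZ (homZ_pre i : {additive homZ F B -> homZ K B})} := \pi.
pose piK' : {additive homZ K' B ->
  cokerZ (homZ_pre i' : {additive homZ F' B -> homZ K' B})} := \pi.
apply: (@isomorphic_of_rel _ _ (fun a b => exists h,
  a = piK h /\ b = piK' (homZ_pre phiK h))).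
- move=> _ _ _ _ [h [-> ->]] [k [-> ->]].
  by exists (h - k); rewrite !raddfB.
- by move=> a; have [h <-] := quot_surj a; exists (piK' (homZ_pre phiK h)), h.
- move=> b; have [h <-] := quot_surj b.
  exists (piK (homZ_pre psiK h)), (homZ_pre psiK h).
  split=> //; apply/subr0_eq; rewrite -raddfB; apply/cokerZ_eq0.
  exists (- homZ_pre s' h); apply: homZ_ext => x.
  have -> : homZ_pre i' (- homZ_pre s' h) x = - h (s' (i' x)) by [].
  by rewrite s'iE raddfB opprB.
- move=> _ [h [/esym/cokerZ_eq0[H <-] ->]]; apply/cokerZ_eq0.
  exists (homZ_pre phi H); apply: homZ_ext => x.
  by rewrite /homZ_pre /= phiKE.
- move=> _ [h [-> /esym/cokerZ_eq0[H Hh]]]; apply/cokerZ_eq0.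
  exists (homZ_pre psi H - homZ_pre s h); apply: homZ_ext => x.
  have -> : homZ_pre i (homZ_pre psi H - homZ_pre s h) x
    = H (psi (i x)) - h (s (i x)) by [].
  have -> : H (psi (i x)) = h (phiK (psiK x)).
    by rewrite -psiKE -[LHS]/(homZ_pre i' H (psiK x)) Hh.
  by rewrite siE raddfB opprB addrC subrK.
Qed.

Lemma Ext1_resolution (K F A B : zmodType)
    (i : {additive K -> F}) (q : {additive F -> A}) :
    short_exact i q -> projectiveZ F ->
  isomorphic (cokerZ (homZ_pre i : {additive homZ F B -> homZ K B})) (Ext1 A B).
Proof.
move=> iq projF.
pose eps : {additive {freeg A / int} -> A} := @freeZ_eps A.
have exact_eps : short_exact (freeZ_incl A) eps.
  split=> [|D|a]; first exact: val_inj.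
    split=> [D0|[x <-]]; last exact/eqP/(valP x).
    have kerD : D \in kerZ eps by apply/eqP.
    by exists (exist _ D kerD).
  by exists << a >>; have := liftU (id : A -> zmodule A) 1 a; rewrite scale1r.
exact: (coker_dual_resolution B iq exact_eps projF (@projectiveZ_freeg A)).
Qed.

(** * Duality between characters and torsion *)

Lemma clear_denominators (a b : nat) (X : 'M[rat]_(a, b)) :
  exists (c : nat) (Y : 'M[int]_(a, b)), (0 < c)%N /\ map_mx intr Y = c%:R *: X.
Proof.
pose D := \prod_ij denq (X ij.1 ij.2).
have D_gt0 : 0 < D by apply: prodr_gt0 => ij _; exact: denq_gt0.
exists `|D|%N.
exists (\matrix_(u, v) (numq (X u v) *
  \prod_(ij | ij != (u, v)) denq (X ij.1 ij.2))).
split; first by rewrite absz_gt0 gt_eqF.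
apply/matrixP => u v; rewrite !mxE natr_absz gtr0_norm //.
rewrite /D [in RHS](bigD1 (u, v)) //= !rmorphM mulrAC; congr (_ * _).
by rewrite -{3}[X u v]divq_num_den mulrC divfK // intr_eq0 denq_eq0.
Qed.

(** An injective integer matrix has independent rows over the rationals as
well, hence a rational right inverse; [c] is a common denominator of it. *)
Lemma rational_left_inverse (k m : nat)
    (i : {additive 'rV[int]_k -> 'rV[int]_m}) :
    injective i ->
  exists (c : nat) (r : {additive 'rV[int]_m -> 'rV[int]_k}),
    (0 < c)%N /\ forall y, r (i y) = y *+ c.
Proof.
move=> i_inj; pose M := \matrix_a i (stdb a).
have iE y : i y = y *m M.
  rewrite additive_rV mulmx_sum_row; apply: eq_bigr => a _.
  by rewrite rowK -scaler_int intz.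
have intmx_inj a b : injective (map_mx intr : 'M[int]_(a, b) -> 'M[rat]_(a, b)).
  move=> P P' /matrixP PP'; apply/matrixP => u v.
  by have := PP' u v; rewrite !mxE => /intr_inj.
have /row_freeP[X MX] : row_free (map_mx intr M : 'M[rat]_(k, m)).
  apply: inj_row_free => v vM0; have [c [y [c_gt0 yE]]] := clear_denominators v.
  have y0 : y = 0.
    apply: i_inj; rewrite raddf0 iE; apply: intmx_inj.
    by rewrite map_mxM /= yE -scalemxAl vM0 scaler0 map_mx0.
  move/esym/eqP: yE; rewrite y0 map_mx0 scaler_eq0 pnatr_eq0.
  by rewrite eqn0Ngt c_gt0 => /eqP.
have [c [Y [c_gt0 YE]]] := clear_denominators X.
have MY : M *m Y = c%:R%:M.
  apply: intmx_inj; rewrite map_mxM /= YE -scalemxAr MX.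
  by rewrite map_scalar_mx rmorph_nat scalemx1.
have [|r rE] := @exists_additive _ _ (fun x : 'rV[int]_m => x *m Y).
  by move=> x y; rewrite mulmxBl.
by exists c, r; split=> // y; rewrite rE iE -mulmxA MY mul_mx_scalar scaler_nat.
Qed.

Lemma primitive_root_exists (F : closedFieldType) (c : nat) :
  c%:R != 0 :> F -> exists w : F, c.-primitive_root w.
Proof.
move=> c_neq0; have c_gt0 : (0 < c)%N.
  by rewrite lt0n; apply: contraNneq c_neq0 => ->.
pose p : {poly F} := 'X^c - 1; have [r Dp] := closed_field_poly_normal p.
rewrite (monicP _) ?monicXnsubC // scale1r in Dp.
have r1 : all c.-unity_root r by apply/allP=> w; rewrite -root_prod_XsubC -Dp.
have sz_r : (c < (size r).+1)%N.
  by rewrite -(size_prod_XsubC r id) -Dp size_XnsubC.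
have [|w] := hasP (has_prim_root c_gt0 r1 _ sz_r); last by exists w.
by rewrite -separable_prod_XsubC -Dp separable_Xn_sub_1.
Qed.

Lemma Gm_val_mulrn (F : fieldType) (t : Gm F) (k : nat) :
  val (t *+ k) = val t ^+ k.
Proof. by elim: k => [|k IHk] //; rewrite mulrS exprS -IHk. Qed.

Lemma Gm_torsion_cyclic (F : closedFieldType) (c : nat) :
    c%:R != 0 :> F ->
  exists u : Gm F, (forall k : int, u *~ k = 0 <-> (c %| k)%Z) /\
    (forall t : Gm F, t *+ c = 0 -> exists k : int, t = u *~ k).
Proof.
move=> /primitive_root_exists[w w_prim].
have c_gt0 := prim_order_gt0 w_prim.
have w_neq0 : w != 0.
  by rewrite -unitfE -(unitrX_pos w c_gt0) // prim_expr_order ?unitr1.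
pose u : Gm F := exist _ w w_neq0.
have u0 (k : nat) : (u *+ k = 0) <-> (c %| k)%N.
  rewrite (prim_order_dvd w_prim) -[w]/(val u) -Gm_val_mulrn.
  by split=> [->|/eqP uk1]; last exact: val_inj.
exists u; split=> [k|t tc0].
  rewrite {1}(intEsign k) dvdzE /= -u0 mulrC mulrzA -pmulrn; case: (k < 0).
    rewrite expr1 mulrN1z; split=> [/(congr1 -%R)|->]; last by rewrite oppr0.
    by rewrite opprK oppr0.
  by rewrite expr0 mulr1z.
have [|j tj] := prim_rootP w_prim (x := val t).
  by rewrite -Gm_val_mulrn tc0.
by exists (j%:Z); apply: val_inj; rewrite -pmulrn Gm_val_mulrn tj.
Qed.

Lemma rV_mulrn_inj (k c : nat) (x y : 'rV[int]_k) :
  (0 < c)%N -> x *+ c = y *+ c -> x = y.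
Proof.
move=> c_gt0 /rowP xy; apply/rowP => a; apply: (pmulrnI c_gt0).
by have := xy a; rewrite !mulmxnE.
Qed.

Lemma rV_dvd (k c : nat) (y : 'rV[int]_k) :
  (forall a, (c %| y 0%R a)%Z) -> exists x, y = x *+ c.
Proof.
move=> cy; exists (\row_a (y 0%R a %/ c)%Z); apply/rowP => a.
by rewrite mulmxnE mxE -mulr_natr natz divzK.
Qed.

Section TorsionDuality.
Variables (F : closedFieldType) (k m : nat) (A : zmodType).
Variables (i : {additive 'rV[int]_k -> 'rV[int]_m}).
Variables (q : {additive 'rV[int]_m -> A}).
Hypothesis iq : short_exact i q.
Hypothesis F_pchar0 : [pchar F] =i pred0.

Let coker := cokerZ (homZ_pre i : {additive dualZ _ -> dualZ _}).
Let piC : {additive dualZ 'rV[int]_k -> coker} := \pi.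

(** A character [chi] and a torsion element [t] correspond to each other when
they come from one solution of [i y = x *+ c]: [chi] has values in the [c]-th
roots of unity, with exponents [y] on the coordinate forms, and [t] is the
class of [x], which stands for [i y] divided by [c]. *)
Lemma dual_coker_Tor : isomorphic (homZ coker (Gm F)) (Tor A).
Proof.
have [i_inj iqE q_surj] := iq.
have [c [r [c_gt0 rE]]] := rational_left_inverse i_inj.
have [|u [u_order u_gen]] := @Gm_torsion_cyclic F c.
  by rewrite ((pcharf0P F).1 F_pchar0) -lt0n.
have piC_im (H : dualZ 'rV[int]_m) : piC (homZ_pre i H) = 0.
  by apply/cokerZ_eq0; exists H.
have dvd_coord (y : 'rV[int]_k) :
    (forall h : dualZ _, u *~ h y = 0) -> exists y', y = y' *+ c.
  by move=> uy; apply: rV_dvd => a; apply/u_order; exact: (uy (stdb_dual a)).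
apply: (@isomorphic_of_rel _ _ (fun (chi : homZ coker (Gm F)) (t : Tor A) =>
  exists y x,
    [/\ i y = x *+ c, forall h, chi (piC h) = u *~ h y & val t = q x])).
- move=> chi t chi' t' [y [x [ixy chiE tE]]] [y' [x' [ixy' chiE' tE']]].
  exists (y - y'), (x - x'); rewrite !raddfB ixy ixy' mulrnBl /= tE tE'.
  by split=> // h; rewrite raddfB /= mulrzBr -chiE -chiE'.
- move=> chi.
  have /choice[y yE] a : exists b : int,
      chi (piC (stdb_dual a : {additive _ -> _})) = u *~ b.
    (* [c] times a coordinate form factors through [i], as [r \o i] is
       multiplication by [c]. *)
    have er : (stdb_dual a : dualZ _) *+ c =
        homZ_pre i (homZ_pre r (stdb_dual a : {additive _ -> _})).
      apply: homZ_ext => v; rewrite -[LHS]/(homZ_eval v _) raddfMn /=.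
      by rewrite -[LHS]raddfMn /= -rE.
    by apply: u_gen; rewrite -!raddfMn er piC_im raddf0.
  pose yv := \row_a y a.
  have chiE h : chi (piC h) = u *~ h yv.
    rewrite {1}[h]dual_rV !raddf_sum additive_rV mulrz_sumr.
    apply: eq_bigr => a _; rewrite !raddfMz /= yE mxE -mulrzA.
    by rewrite -mulrzA mulrC.
  have [x ixy] : exists x, i yv = x *+ c.
    apply: rV_dvd => b; apply/u_order.
    rewrite -[i yv 0 b]/(homZ_pre i (stdb_dual b : {additive _ -> _}) yv).
    by rewrite -chiE piC_im raddf0.
  have qx_tors : q x \in @torsionZ A.
    apply/asboolP; exists c => //.
    by rewrite -raddfMn /= -ixy (short_exact_comp0 iq).
  by exists (exist _ (q x) qx_tors), yv, x.
- move=> [a a_tors]; have /asboolP[n n_gt0 an0] := a_tors.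
  have [x qx] := q_surj a.
  have /iqE[y0 iy0] : q (x *+ n) = 0 by rewrite raddfMn /= qx.
  (* Only a multiple of [x] lies in the range of [i], but the vectors are
     torsion-free, so this identity may be checked after multiplying by [n]. *)
  have irx : i (r x) = x *+ c.
    apply: (rV_mulrn_inj n_gt0).
    have -> : i (r x) *+ n = i (r (x *+ n)) by rewrite !raddfMn.
    by rewrite -iy0 rE raddfMn /= iy0 -!mulrnA mulnC.
  have [|w wE] := @exists_additive (dualZ 'rV[int]_k) (Gm F)
    (fun h => u *~ h (r x)).
    by move=> g h /=; rewrite -mulrzBr.
  have [|chi chiE] := @quot_lift _
    (imZ (homZ_pre i : {additive dualZ _ -> dualZ _})) (Gm F) w.
    move=> _ /asboolP[H <-]; rewrite wE /homZ_pre /= irx raddfMn.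
    by apply/u_order; rewrite -mulr_natr natz dvdz_mull.
  by exists chi, (r x), x; split=> // h; rewrite -wE -chiE.
- move=> t [y [x [ixy chiE tE]]].
  have [|y' yE] := dvd_coord y; first by move=> h; rewrite -chiE.
  apply: val_inj; rewrite /= tE.
  have <- : i y' = x.
    by apply: (rV_mulrn_inj c_gt0); rewrite -ixy yE raddfMn.
  exact: (short_exact_comp0 iq).
- move=> chi [y [x [ixy chiE /esym/iqE[y' iy']]]].
  have yE : y = y' *+ c by apply: i_inj; rewrite raddfMn /= iy'.
  apply: homZ_ext => D; have [h <-] := quot_surj D.
  rewrite -[LHS]/(chi (piC h)) chiE yE raddfMn; apply/u_order.
  by rewrite -mulr_natr natz dvdz_mull.
Qed.

End TorsionDuality.

(** * The stabilizer as a group of characters *)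

(** The subgroup cut out by the vanishing of the coordinates in [P] is given
by a parametrization [s] with a retraction [r], rather than as a subtype, so
that it is literally a [Z^k]. *)
Lemma coordinate_subgroup_basis (N : nat) (P : pred 'I_N) :
  exists (k : nat) (s : {additive 'rV[int]_k -> 'rV[int]_N})
      (r : {additive 'rV[int]_N -> 'rV[int]_k}),
    cancel s r /\
    forall v, (exists y, s y = v) <-> (forall j, P j -> v 0 j = 0).
Proof.
pose k := #|[predC P]|.
pose E : 'M[int]_(k, N) := \matrix_(a, j) (enum_val a == j)%:R.
have [|s sE] := @exists_additive _ _ (fun y : 'rV[int]_k => y *m E).
  by move=> x y; rewrite mulmxBl.
have [|r rE] := @exists_additive _ _
    (fun v : 'rV[int]_N => \row_(a < k) v 0 (enum_val a)).
  by move=> v w; apply/rowP => a; rewrite !mxE.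
have s_val y (b : 'I_k) : s y 0 (enum_val b) = y 0 b.
  rewrite sE mxE (bigD1 b) //= mxE eqxx mulr1 big1 ?addr0 // => a ab.
  by rewrite mxE (inj_eq enum_val_inj) (negbTE ab) mulr0.
have s_P y j : P j -> s y 0 j = 0.
  move=> Pj; rewrite sE mxE big1 // => a _; rewrite mxE.
  case: eqP => [aj|]; last by rewrite mulr0.
  by have /negP[] : j \in [predC P]; first by rewrite -aj enum_valP.
exists k, s, r; split=> [y|v].
  by apply/rowP => a; rewrite rE mxE s_val.
split=> [[y <-] j /s_P // | v0]; exists (r v); apply/rowP => j.
case: (boolP (P j)) => [Pj|nPj]; first by rewrite s_P // v0.
have jP : j \in [predC P] by [].
by rewrite -(enum_rankK_in jP jP) s_val rE mxE.
Qed.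

Section Stabilizer.
Variables (K : fieldType) (n l m k : nat).
Variables (B : {additive 'rV[int]_n -> 'rV[int]_m}).
Variables (Q : {additive 'rV[int]_l -> 'rV[int]_m}).
Variables (z : 'rV[K]_n).
Variables (s : {additive 'rV[int]_k -> 'rV[int]_(n + l)}).
Variables (r : {additive 'rV[int]_(n + l) -> 'rV[int]_k}).
Hypothesis sK : cancel s r.
Hypothesis s_range : forall v,
  (exists y, s y = v) <-> (forall j, z 0 j != 0 -> v 0 (lshift l j) = 0).

Let i : {additive 'rV[int]_k -> 'rV[int]_m} := BQ B Q \o s.
Let coker := cokerZ (homZ_pre i : {additive dualZ _ -> dualZ _}).
Let piC : {additive dualZ 'rV[int]_k -> coker} := \pi.
Let piDG : {additive dualZ 'rV[int]_(n + l) -> DG B Q} := \pi.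

Let eL (j : 'I_n) : dualZ 'rV[int]_(n + l) :=
  homZ_pre lsubmx (stdb_dual j : {additive _ -> _}).

Lemma G_to_torusE (g : toric_group K B Q) j : G_to_torus g j = g (piDG (eL j)).
Proof. by []. Qed.

Lemma stabP (g : toric_group K B Q) :
  g \in stab z <-> forall j, z 0 j != 0 -> g (piDG (eL j)) = 0.
Proof.
split=> [/eqP/rowP gz j zj|gz].
  apply: val_inj; apply: (mulIf zj); rewrite val_Gm0 mul1r -[RHS]gz mxE.
  by rewrite G_to_torusE.
apply/eqP/rowP => j; rewrite mxE G_to_torusE.
have [->|zj] := eqVneq (z 0 j) 0; first by rewrite mulr0.
by rewrite gz // val_Gm0 mul1r.
Qed.

Lemma dual_vanishing (h : dualZ 'rV[int]_(n + l)) :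
    (forall y, h (s y) = 0) ->
  h = \sum_(j | z 0 j != 0) eL j *~ h (stdb (lshift l j)).
Proof.
move=> hs0; apply: homZ_ext => v.
pose w := \sum_(j | z 0 j != 0) stdb (lshift l j) *~ v 0 (lshift l j).
have [y sy] : exists y, s y = v - w.
  apply/s_range => j zj; rewrite !mxE summxE (bigD1 j) //= big1 => [|a /andP[_ aj]].
    by rewrite -scaler_int !mxE !eqxx mulr1 intz addr0 subrr.
  by rewrite -scaler_int !mxE eq_lshift (eq_sym j) (negbTE aj) andbF mulr0.
have -> : h v = h w by apply/subr0_eq; rewrite -raddfB -sy hs0.
rewrite raddf_sum -[RHS]/(homZ_eval v _) raddf_sum; apply: eq_bigr => j _.
by rewrite !raddfMz /homZ_eval /homZ_pre /= /stdb_dual mxE !mulrzz mulrC.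
Qed.

(** Restriction of forms along [s] maps [DG] onto [coker], and by
[dual_vanishing] its kernel is generated by the classes of the forms that the
elements of the stabilizer kill. *)
Lemma Stab_dual_coker : isomorphic (Stab B Q z) (homZ coker (Gm K)).
Proof.
have piC_im (H : dualZ 'rV[int]_m) : piC (homZ_pre i H) = 0.
  by apply/cokerZ_eq0; exists H.
have piDG_im (H : dualZ 'rV[int]_m) : piDG (homZ_pre (BQ B Q) H) = 0.
  by apply/cokerZ_eq0; exists H.
have pre_i (H : dualZ 'rV[int]_m) :
    homZ_pre i H = homZ_pre s (homZ_pre (BQ B Q) H).
  exact: homZ_ext.
have stab_rs (g : toric_group K B Q) (h : dualZ _) : g \in stab z ->
    g (piDG (homZ_pre r (homZ_pre s h))) = g (piDG h).
  move=> /stabP gz; apply/subr0_eq; rewrite -!raddfB.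
  rewrite (dual_vanishing (h := homZ_pre r (homZ_pre s h) - h)) => [|y].
    by rewrite !raddf_sum big1 // => j zj; rewrite !raddfMz /= gz // mul0rz.
  by rewrite -[LHS]/(h (s (r (s y))) - h (s y)) sK subrr.
have pre_rs (h : dualZ _) : homZ_pre s (homZ_pre r h) = h.
  by apply: homZ_ext => y; rewrite /homZ_pre /= sK.
apply: (@isomorphic_of_rel _ _
  (fun (g : Stab B Q z) (chi : homZ coker (Gm K)) => forall h,
    (val g : toric_group K B Q) (piDG h) = chi (piC (homZ_pre s h)))).
- move=> g chi g' chi' gE chiE h.
  by rewrite raddfB -[RHS]/(chi _ - chi' _) -gE -chiE.
- move=> [g gz].
  have [|chi chiE] := @quot_lift _
      (imZ (homZ_pre i : {additive dualZ _ -> dualZ _})) (Gm K)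
      (g \o piDG \o homZ_pre r).
    move=> _ /asboolP[H <-] /=.
    by rewrite pre_i -[RHS](raddf0 g) -[in RHS](piDG_im H) stab_rs.
  by exists chi => h; rewrite chiE /= stab_rs.
- move=> chi.
  have [|g gE] := @quot_lift _
      (imZ (homZ_pre (BQ B Q) : {additive dualZ _ -> dualZ _})) (Gm K)
      (chi \o piC \o homZ_pre s).
    by move=> _ /asboolP[H <-] /=; rewrite -pre_i piC_im raddf0.
  have gz : g \in stab z.
    apply/stabP => j zj; rewrite gE /=.
    suff -> : homZ_pre s (eL j) = 0 by rewrite !raddf0.
    apply: homZ_ext => y.
    have /s_range/(_ j zj) : exists x, s x = s y by exists y.
    by move=> sy; rewrite -[RHS]sy /homZ_pre /= /stdb_dual mxE.
  by exists (exist _ g gz).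
- move=> chi chi0; apply: homZ_ext => D; have [h <-] := quot_surj D.
  by rewrite -[h]pre_rs -[LHS]chi0.
- move=> g g0; apply: val_inj; apply: homZ_ext => D; have [h <-] := quot_surj D.
  exact: g0.
Qed.

End Stabilizer.

(** * Rays of a simplicial cone *)

Section Cones.
Variables (R : realType) (V : vectType R).
Implicit Types (v : V) (vs : seq V).

Lemma cone1P v x : cone [:: v] x <-> exists2 a : R, 0 <= a & x = a *: v.
Proof.
split=> [[a a_ge0 ->]|[a a_ge0 ->]].
  by exists (a ord0); rewrite ?a_ge0 // big_ord1.
by exists (fun=> a); rewrite // big_ord1.
Qed.

Lemma mem_cone vs (i : 'I_(size vs)) : cone vs vs`_i.
Proof.
exists (fun j => (j == i)%:R); first by move=> j; rewrite ler0n.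
rewrite (bigD1 i) //= eqxx scale1r big1 ?addr0 // => j /negbTE->.
by rewrite scale0r.
Qed.

(** If [u] cuts out the face, then [u v = 0] is a sum of the nonnegative terms
[a_i * u vs_i], so every [vs_i] that occurs in [v] lies on the face, which is
the ray of [v]. *)
Lemma face_ray_generator vs v :
    v != 0 -> is_face (cone [:: v]) (cone vs) ->
  exists (i : 'I_(size vs)) (c : R), 0 < c /\ v = c *: vs`_i.
Proof.
move=> v_neq0 [u u_ge0 face_eq].
have [[a a_ge0 vE] /= uv0] : (cone vs `&` [set x | u x = 0]) v.
  by rewrite -face_eq; apply/cone1P; exists 1; rewrite ?scale1r.
have au_ge0 i : 0 <= a i * u vs`_i.
  by rewrite mulr_ge0 ?a_ge0 // u_ge0 //; exact: mem_cone.
have au0 i : a i * u vs`_i = 0.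
  have : \sum_j a j * u vs`_j = 0.
    by rewrite -[RHS]uv0 vE raddf_sum; apply: eq_bigr => j _; rewrite /= linearZ.
  by move=> /eqP; rewrite psumr_eq0 // => /allP/(_ i (mem_index_enum i))/eqP.
have [i avi_neq0] : exists i, a i *: vs`_i != 0.
  apply/existsP; apply: contraNT v_neq0 => /existsPn av0.
  by rewrite vE big1 // => i _; apply/eqP; rewrite -[_ == _]negbK.
move: avi_neq0; rewrite scaler_eq0 negb_or => /andP[ai_neq0 vi_neq0].
have ui0 : u vs`_i = 0 by apply: (mulfI ai_neq0); rewrite au0 mulr0.
have /cone1P[b b_ge0 viE] : cone [:: v] vs`_i.
  by rewrite face_eq; split=> //; exact: mem_cone.
have b_gt0 : 0 < b.
  rewrite lt0r b_ge0 andbT; apply: contraNneq vi_neq0 => b0.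
  by rewrite viE b0 scale0r.
by exists i, b^-1; rewrite invr_gt0 viE scalerA mulVf ?gt_eqF // scale1r.
Qed.

End Cones.

Section StackyFan.
Variables (R : realType) (N : zmodType) (V : vectType R).
Variables (iota : {additive N -> V}) (d n : nat).
Variables (Sigma : set (set V)) (rho : 'I_n -> set V).
Variable beta : {additive 'rV[int]_n -> N}.
Hypothesis hfan : is_stacky_fan iota d Sigma rho beta.

Lemma stacky_ray_neq0 j : iota (beta (stdb j)) != 0.
Proof.
have : range rho (rho j) by exists j.
rewrite (sf_rho hfan) => -[_ [v v_neq0 rhojE]].
have : cone [:: v] v by apply/cone1P; exists 1; rewrite ?scale1r.
rewrite -rhojE (sf_beta hfan) => /cone1P[a _ vE].
by apply: contraNneq v_neq0 => b0; rewrite vE b0 scaler0.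
Qed.

(** The intersection axiom makes a ray contained in [sigma] a face of [sigma],
so its generator is a positive multiple of an element of the basis that spans
[sigma]; distinct rays give distinct basis elements. *)
Lemma cone_rays_free (sigma : set V) (y : 'I_n -> R) :
    Sigma sigma -> (forall j, y j != 0 -> rho j `<=` sigma) ->
    \sum_j y j *: iota (beta (stdb j)) = 0 ->
  forall j, y j = 0.
Proof.
move=> Ssigma y_sigma sum0.
have [vs vs_free sigmaE] := fan_simplicial (sf_fan hfan) Ssigma.
(* A pair [(index, factor)]; the index is a [nat] because [vs] may be empty, in
   which case the pair [(0, 0)] serves for the [j] outside the support. *)
have /choice[ic icP] j : exists ic : nat * R, y j != 0 ->
    [/\ (ic.1 < size vs)%N, 0 < ic.2 & iota (beta (stdb j)) = ic.2 *: vs`_ic.1].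
  have [yj0|/y_sigma rhoj_sigma] := eqVneq (y j) 0; first by exists (0%N, 0).
  have Srho : Sigma (rho j).
    have : range rho (rho j) by exists j.
    by rewrite (sf_rho hfan) => -[].
  have [_] := fan_meet (sf_fan hfan) Srho Ssigma.
  rewrite (setIidl rhoj_sigma) sigmaE (sf_beta hfan).
  move=> /(face_ray_generator (stacky_ray_neq0 j))[i [c [c_gt0 bE]]].
  by exists (i : nat, c); split=> /=.
have ic_inj j j' : y j != 0 -> y j' != 0 -> (ic j).1 = (ic j').1 -> j = j'.
  move=> /icP[_ cj jE] /icP[_ cj' j'E] ii'; apply: (sf_rho_inj hfan).
  rewrite !(sf_beta hfan) jE j'E ii'.
  move: (ic j).2 (ic j').2 cj cj' => c c' c0 c'0.
  have [c_ge0 c'_ge0] := (ltW c0, ltW c'0).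
  apply/seteqP; split=> x /cone1P[a a_ge0 ->]; apply/cone1P.
    by exists (a * c / c'); rewrite ?divr_ge0 ?mulr_ge0 // !scalerA divfK ?gt_eqF.
  by exists (a * c' / c); rewrite ?divr_ge0 ?mulr_ge0 // !scalerA divfK ?gt_eqF.
move=> j; apply/eqP; apply: contraT => yj_neq0.
have [ij cj jE] := icP j yj_neq0.
(* The coordinate form of the basis element on the [j]-th ray isolates [y j]. *)
have [f f_vs] : exists f : {linear V -> R^o},
    forall i' : 'I_(size vs), f vs`_i' = (i' == Ordinal ij)%:R.
  exists (coord (in_tuple vs) (Ordinal ij)) => i'.
  exact: (coord_free i' (Ordinal ij) (X := in_tuple vs)).
have fE j' : y j' != 0 ->
    f (iota (beta (stdb j'))) = (ic j').2 * (j' == j)%:R.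
  move=> yj'_neq0; have [ij' _ ->] := icP j' yj'_neq0.
  rewrite linearZ (f_vs (Ordinal ij')).
  congr (_ * (nat_of_bool _)%:R); rewrite -val_eqE /=.
  by apply/eqP/eqP => [|-> //]; exact: ic_inj.
have := congr1 f sum0; rewrite raddf0 raddf_sum (bigD1 j) //= big1 => [|j' j'j].
  rewrite addr0 linearZ /= fE // eqxx mulr1 => /eqP.
  by rewrite mulf_eq0 (gt_eqF cj) orbF (negbTE yj_neq0).
rewrite linearZ /=.
have [->|yj'_neq0] := eqVneq (y j') 0; first by rewrite scale0r.
by rewrite fE // (negbTE j'j) mulr0 scaler0.
Qed.

Lemma cone_beta_injective (sigma : set V) (x : 'rV[int]_n) :
    Sigma sigma -> (forall j, x 0 j != 0 -> rho j `<=` sigma) ->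
  beta x = 0 -> x = 0.
Proof.
move=> Ssigma x_sigma bx0; apply/rowP => j; rewrite mxE; apply/eqP.
rewrite -(intr_eq0 R); apply/eqP; move: j.
apply: (cone_rays_free Ssigma) => [j|]; first by rewrite intr_eq0; exact: x_sigma.
rewrite -[RHS](raddf0 iota) -bx0 additive_rV raddf_sum.
by apply: eq_bigr => j _; rewrite raddfMz scaler_int.
Qed.

End StackyFan.

(** * The resolution of N / N_z *)

Section NZero.
Variables (N : zmodType) (K : fieldType) (n : nat).
Variables (beta : {additive 'rV[int]_n -> N}) (z : 'rV[K]_n).

Lemma mem_N_zero a : a \in N_zero beta z <->
  exists2 w : 'rV[int]_n, (forall j, z 0 j != 0 -> w 0 j = 0) & beta w = a.
Proof.
split=> [/asboolP aN|[w w0 <-]].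
  have [k [s [r [_ s_range]]]] :=
    coordinate_subgroup_basis (fun j => z 0 j != 0).
  have /asboolP[y <-] : a \in imZ (beta \o s).
    apply: aN => _ [j /= zj0 <-]; apply/asboolP.
    have [y sy] : exists y, s y = stdb j.
      apply/s_range => j' zj'; rewrite mxE eqxx /=.
      by have [j'j|//] := eqVneq j' j; rewrite j'j zj0 eqxx in zj'.
    by exists y; rewrite /= sy.
  by exists (s y) => //; apply/s_range; exists y.
rewrite additive_rV rpred_sum // => j _.
have [zj0|/w0->] := eqVneq (z 0 j) 0; last by rewrite mulr0z rpred0.
by apply: rpredMz; apply/asboolP => I SI; apply: SI; exists j.
Qed.

Lemma short_exact_quot_N_zero (l m k : nat)
    (Q : {additive 'rV[int]_l -> 'rV[int]_m}) (p : {additive 'rV[int]_m -> N})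
    (B : {additive 'rV[int]_n -> 'rV[int]_m})
    (s : {additive 'rV[int]_k -> 'rV[int]_(n + l)}) :
    short_exact Q p -> (forall x, p (B x) = beta x) -> injective s ->
    (forall v, (exists y, s y = v) <->
      (forall j, z 0 j != 0 -> v 0 (lshift l j) = 0)) ->
    (forall w : 'rV[int]_n,
      (forall j, z 0 j != 0 -> w 0 j = 0) -> beta w = 0 -> w = 0) ->
  short_exact (BQ B Q \o s : {additive _ -> _})
    (\pi \o p : {additive 'rV[int]_m -> Quotient.quot (N_zero beta z)}).
Proof.
move=> hQ hB s_inj s_range beta_inj; have [Q_inj pE p_surj] := hQ.
have s0 y j : z 0 j != 0 -> lsubmx (s y) 0 j = 0.
  by move=> zj; rewrite mxE; apply/s_range: j zj; exists y.
have p_BQ v : p (BQ B Q v) = beta (lsubmx v).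
  by rewrite /BQ /= raddfD /= hB (short_exact_comp0 hQ) addr0.
split=> [|x|c].
- apply: raddf_inj => y iy0; apply: s_inj; rewrite raddf0.
  have sy0 : lsubmx (s y) = 0.
    apply: beta_inj => [j|]; first exact: s0.
    by rewrite -p_BQ -[BQ B Q _]/((BQ B Q \o s) y) iy0 raddf0.
  rewrite -[s y]hsubmxK sy0.
  suff -> : rsubmx (s y) = 0 by rewrite row_mx0.
  by apply: Q_inj; rewrite raddf0 -[RHS]iy0 /BQ /= sy0 raddf0 add0r.
- split=> [/quot_eq0/mem_N_zero[w w0 bw]|[y <-]]; last first.
    by apply/quot_eq0/mem_N_zero; exists (lsubmx (s y)); rewrite ?p_BQ // => j /s0.
  have /pE[t Qt] : p (x - B w) = 0 by rewrite raddfB hB bw subrr.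
  have [y sy] : exists y, s y = row_mx w t.
    by apply/s_range => j zj; rewrite row_mxEl w0.
  by exists y; rewrite /BQ /= sy row_mxKl row_mxKr Qt addrC subrK.
- by have [a <-] := quot_surj c; have [x <-] := p_surj a; exists x.
Qed.

End NZero.


Theorem theorem2p2 (R : realType) (N : zmodType) (V : vectType R)
    (iota : {additive N -> V}) (d n : nat)
    (Sigma : set (set V)) (rho : 'I_n -> set V)
    (beta : {additive 'rV[int]_n -> N})
    (hfan : is_stacky_fan iota d Sigma rho beta)
    (l : nat) (Q : {additive 'rV[int]_l -> 'rV[int]_(d + l)})
    (p : {additive 'rV[int]_(d + l) -> N})
    (hQ : short_exact Q p)
    (B : {additive 'rV[int]_n -> 'rV[int]_(d + l)})
    (hB : forall x, p (B x) = beta x)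
    (z : 'rV[R[i]]_n) (hz : Z_Sigma Sigma rho z) :
  isomorphic (Stab B Q z) (homZ (Ext1 (Quotient.quot (N_zero beta z)) int) (Gm R[i]))
  /\ isomorphic (Stab B Q z) (Tor (Quotient.quot (N_zero beta z))).
Proof.
have [sigma Ssigma z_sigma] := hz.
pose P (j : 'I_(n + l)) :=
  if fintype.split j is inl j' then z 0 j' != 0 else false.
have [k [s [r [sK s_range]]]] := coordinate_subgroup_basis P.
have {}s_range v : (exists y, s y = v) <->
    (forall j, z 0 j != 0 -> v 0 (lshift l j) = 0).
  rewrite s_range; split=> v0 j.
    by move=> zj; apply: v0; rewrite /P (unsplitK (inl j)).
  by rewrite /P; case: split_ordP => // j' -> /v0.
have beta_inj (w : 'rV[int]_n) :
    (forall j, z 0 j != 0 -> w 0 j = 0) -> beta w = 0 -> w = 0.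
  move=> w0; apply: (cone_beta_injective hfan Ssigma) => j wj.
  by apply: z_sigma; apply: contraNeq wj => /w0->.
have iq := short_exact_quot_N_zero hQ hB (can_inj sK) s_range beta_inj.
split; apply: (isomorphic_trans (Stab_dual_coker B Q sK s_range)).
  exact/isomorphic_homZ/(Ext1_resolution int iq)/projectiveZ_rV.
exact: dual_coker_Tor iq (@pchar_num _).
Qed.
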